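(* Let $\mathfrak{B}$ be a bornology with a closed base $\mathfrak{B}_0$ on a topological space $X$, let $Y$ be a topological space, let $g:X\to Y$ be a continuous function, and let $\Pi\in\{S_1,S_{fin},U_{fin}\}$. The following hold. (1) If $X$ satisfies $\Pi(\mathcal{O}_{\mathfrak{B}},\mathcal{O}_{\mathfrak{B}})$, then $g(X)$ satisfies $\Pi(\mathcal{O}_{g(\mathfrak{B})},\mathcal{O}_{g(\mathfrak{B})})$. (2) If $X$ satisfies $\Pi(\mathcal{O}_{\mathfrak{B}},\Gamma_{\mathfrak{B}})$, then $g(X)$ satisfies $\Pi(\mathcal{O}_{g(\mathfrak{B})},\Gamma_{g(\mathfrak{B})})$. (3) If $X$ satisfies $\Pi(\Gamma_{\mathfrak{B}},\Gamma_{\mathfrak{B}})$, then $g(X)$ satisfies $\Pi(\Gamma_{g(\mathfrak{B})},\Gamma_{g(\mathfrak{B})})$. (4) If $X$ satisfies $\Pi(\Gamma_{\mathfrak{B}},\mathcal{O}_{\mathfrak{B}})$, then $g(X)$ satisfies $\Pi(\Gamma_{g(\mathfrak{B})},\mathcal{O}_{g(\mathfrak{B})})$.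
   Context: A bornology $\mathfrak{B}$ on a space $X$ is a family of subsets of $X$ that is closed under taking subsets and finite unions and covers $X$; by standing convention $X\notin\mathfrak{B}$. A base of $\mathfrak{B}$ is a subfamily $\mathfrak{B}_0\subseteq\mathfrak{B}$ such that every $B\in\mathfrak{B}$ is contained in some $B_0\in\mathfrak{B}_0$; it is closed if its members are closed subsets of $X$. For $g:X\to Y$, $g(\mathfrak{B})=\{g(B):B\in\mathfrak{B}\}$, a family of subsets of $g(X)$ (the subspace of $Y$). For such a family $\mathfrak{C}$ of subsets of a space $Z$ (here $(Z,\mathfrak{C})=(X,\mathfrak{B})$ or $(g(X),g(\mathfrak{B}))$): $\mathcal{O}_{\mathfrak{C}}$ is the collection of all open $\mathfrak{C}$-covers of $Z$, i.e. families $\mathcal{U}$ of open subsets of $Z$ with $Z\notin\mathcal{U}$ such that every $C\in\mathfrak{C}$ is contained in some $U\in\mathcal{U}$; $\Gamma_{\mathfrak{C}}$ is the collection of all $\gamma_{\mathfrak{C}}$-covers of $Z$, i.e. infinite covers $\{U_n:n\in\omega\}$ of $Z$ by proper open subsets such that for each $C\in\mathfrak{C}$ there is $n_0$ with $C\subseteq U_n$ for all $n\ge n_0$. For collections $\mathcal{A},\mathcal{B}$ of families of subsets of $Z$ and every sequence $\{\mathcal{U}_n:n\in\omega\}$ of elements of $\mathcal{A}$: $S_1(\mathcal{A},\mathcal{B})$ requires $V_n\in\mathcal{U}_n$ with $\{V_n:n\in\omega\}\in\mathcal{B}$; $S_{fin}(\mathcal{A},\mathcal{B})$ requires finite (possibly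 empty) $\mathcal{V}_n\subseteq\mathcal{U}_n$ with $\bigcup_{n\in\omega}\mathcal{V}_n\in\mathcal{B}$; $U_{fin}(\mathcal{A},\mathcal{B})$ requires finite (possibly empty) $\mathcal{V}_n\subseteq\mathcal{U}_n$ such that $\{\bigcup\mathcal{V}_n:n\in\omega\}\in\mathcal{B}$ or $\bigcup\mathcal{V}_n=Z$ for some $n$. *)

(* Defs.v *)
From mathcomp Require Import all_boot all_order all_algebra.
From mathcomp Require Import all_classical all_reals all_analysis.

Set Implicit Arguments.
Unset Strict Implicit.
Unset Printing Implicit Defensive.

Local Open Scope classical_set_scope.

(* The last clause (X is not bounded) is a standing convention on bornologies. *)
Definition is_bornology (X : Type) (B : set (set X)) : Prop :=
  [/\ forall A A' : set X, B A -> A' `<=` A -> B A',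
      forall A A' : set X, B A -> B A' -> B (A `|` A'),
      \bigcup_(A in B) A = setT &
      ~ B setT].

Definition is_base (X : Type) (B B0 : set (set X)) : Prop :=
  B0 `<=` B /\ forall A, B A -> exists2 A0, B0 A0 & A `<=` A0.

Definition is_closed_base (X : topologicalType) (B B0 : set (set X)) : Prop :=
  is_base B B0 /\ forall A0, B0 A0 -> closed A0.

(* Here [range g] is coerced to the type of its elements, which carries the
   subspace topology induced by Y; g(A) is viewed as a subset of that type. *)
Definition image_family (X Y : Type) (g : X -> Y) (B : set (set X)) :
    set (set (range g)) :=
  [set set_val @^-1` (g @` A) | A in B].
Arguments image_family {X Y} g B.

Definition open_covers (Z : topologicalType) (C : set (set Z)) :
    set (set (set Z)) :=
  [set U | [/\ forall W, U W -> open W,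
               ~ U setT &
               forall A, C A -> exists2 W, U W & A `<=` W]].

(* A cover is an unindexed family: infinitude concerns the set of its members,
   and the enumeration u is allowed to repeat members. *)
Definition gamma_covers (Z : topologicalType) (C : set (set Z)) :
    set (set (set Z)) :=
  [set U | infinite_set U /\
    exists u : nat -> set Z,
      [/\ U = range u,
          forall n, open (u n) /\ u n <> setT,
          \bigcup_n u n = setT &
          forall A, C A ->
            exists n0, forall n, (n0 <= n)%N -> A `<=` u n]].

Definition S1 (Z : Type) (A B : set (set (set Z))) : Prop :=
  forall U : nat -> set (set Z), (forall n, A (U n)) ->
  exists V : nat -> set Z, (forall n, U n (V n)) /\ B (range V).

Definition Sfin (Z : Type) (A B : set (set (set Z))) : Prop :=
  forall U : nat -> set (set Z), (forall n, A (U n)) ->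
  exists V : nat -> set (set Z),
    (forall n, finite_set (V n) /\ V n `<=` U n) /\ B (\bigcup_n V n).

Definition Ufin (Z : Type) (A B : set (set (set Z))) : Prop :=
  forall U : nat -> set (set Z), (forall n, A (U n)) ->
  exists V : nat -> set (set Z),
    (forall n, finite_set (V n) /\ V n `<=` U n) /\
    (B (range (fun n => \bigcup_(W in V n) W)) \/
     exists n, \bigcup_(W in V n) W = setT).

Inductive selection_principle := Sel_S1 | Sel_Sfin | Sel_Ufin.

Definition selects (P : selection_principle) (Z : Type)
    (A B : set (set (set Z))) : Prop :=
  match P with
  | Sel_S1 => S1 A B
  | Sel_Sfin => Sfin A B
  | Sel_Ufin => Ufin A B
  end.

(* Main.v *)
Require Import Defs.
From mathcomp Require Import all_boot all_order all_algebra.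
From mathcomp Require Import all_classical all_reals all_analysis.

Local Open Scope classical_set_scope.

(** Corestricting [g] to its range gives a continuous surjection [h] from [X]
    onto [Z], the subspace [range g] of [Y], and the family [g(B)] consists of
    the sets [h @` A] with [A] in [B].  For such an [h] the covers of [Z] are
    governed by their preimages:
    - [h @` A] lies in [W] exactly when [A] lies in [h @^-1` W];
    - [W] is all of [Z] exactly when [h @^-1` W] is all of [X];
    - distinct subsets of [Z] have distinct preimages, so that taking
      preimages preserves and reflects infinitude of a family.
    Hence a family of open subsets of [Z] is an open [g(B)]-cover, or a
    gamma-cover for [g(B)], iff the family of its preimages is such a cover
    for [B] ([open_covers_preimage], [gamma_covers_preimage]).

    A selection principle then descends from [X] to [Z]
    ([selects_preimage]): pull the given covers back along [h], select in [X],
    and push the selected sets forward.  Every set selected in [X] is the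
    preimage of its own image, and that image is a member of the original
    cover; preimages also commute with unions, which is what [Ufin] needs. *)

(** * Families of sets and their preimages under a surjection *)

Lemma preimage_inj {X Z : Type} {h : X -> Z} (hs : range h = setT) :
  injective (preimage h).
Proof. by apply: (can_inj (g := image^~ h)) => W; exact: image_preimage. Qed.

Lemma preimage_eqT {X Z : Type} {h : X -> Z} (hs : range h = setT)
    (W : set Z) :
  h @^-1` W = setT <-> W = setT.
Proof.
split=> [|->]; last exact: preimage_setT.
by rewrite -{1}(preimage_setT h) => /(preimage_inj hs).
Qed.

Lemma image_of_preimages_sub {X Z : Type} {h : X -> Z} (hs : range h = setT)
    {U : set (set Z)} {V : set (set X)} :
  V `<=` preimage h @` U -> image^~ h @` V `<=` U.
Proof.
move=> VU _ [W VW <-]; have [W' UW' <-] := VU _ VW.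
by rewrite image_preimage.
Qed.

Lemma preimages_of_image {X Z : Type} {h : X -> Z} (hs : range h = setT)
    {U : set (set Z)} {V : set (set X)} :
  V `<=` preimage h @` U -> preimage h @` (image^~ h @` V) = V.
Proof.
move=> VU; rewrite image_comp -[RHS]image_id.
by apply: eq_imagel => W /VU[W' _ <-] /=; rewrite image_preimage.
Qed.

Lemma range_preimage {X Z : Type} (h : X -> Z) (w : nat -> set Z) :
  preimage h @` range w = range (fun n => h @^-1` w n).
Proof. by rewrite image_comp. Qed.

(** * Covers and preimages *)

Lemma open_covers_open {Z : topologicalType} {C : set (set Z)}
    {F : set (set Z)} :
  open_covers C F -> F `<=` open.
Proof. by case. Qed.

Lemma gamma_covers_open {Z : topologicalType} {C : set (set Z)}
    {F : set (set Z)} :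
  gamma_covers C F -> F `<=` open.
Proof. by move=> [_ [u [-> uo _ _]]] _ [n _ <-]; case: (uo n). Qed.

(** Openness of the members of [F] is assumed because [h] need not be a
    quotient map: an open preimage does not make a set open. *)
Lemma open_covers_preimage {X Z : topologicalType} {h : X -> Z}
    (hc : continuous h) (hs : range h = setT) (C : set (set X))
    (F : set (set Z)) (Fo : F `<=` open) :
  open_covers (image^~ h @` C) F <-> open_covers C (preimage h @` F).
Proof.
split=> -[_ FT FC]; split=> //.
- by move=> _ [W /Fo Wo <-]; move/continuousP: hc; exact.
- by move=> [W FW /(preimage_eqT hs) WT]; rewrite WT in FW.
- move=> K CK; have [|W FW KW] := FC (h @` K); first by exists K.
  by exists (h @^-1` W); [exists W | rewrite -image_sub].
- by move=> FZ; apply: FT; exists setT => //; exact: preimage_setT.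
- move=> _ [K CK <-]; have [_ [W FW <-] KW] := FC _ CK.
  by exists W => //; rewrite image_sub.
Qed.

Lemma gamma_covers_preimage {X Z : topologicalType} {h : X -> Z}
    (hc : continuous h) (hs : range h = setT) (C : set (set X))
    (F : set (set Z)) (Fo : F `<=` open) :
  gamma_covers (image^~ h @` C) F <-> gamma_covers C (preimage h @` F).
Proof.
split=> -[Finf [u [Fu uo uT uC]]]; split.
- move=> fin; apply: Finf.
  suff -> : F = image^~ h @` (preimage h @` F) by exact: finite_image.
  rewrite image_comp -[LHS]image_id.
  by apply: eq_imagel => W _ /=; rewrite image_preimage.
- exists (fun n => h @^-1` u n); split.
  + by rewrite Fu range_preimage.
  + move=> n; have [un_open un_proper] := uo n; split.
      by move/continuousP: hc; exact.
    by move/(preimage_eqT hs).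
  + by rewrite -preimage_bigcup uT preimage_setT.
  + move=> K CK; have [|n0 uK] := uC (h @` K); first by exists K.
    by exists n0 => n /uK; rewrite image_sub.
- by move=> fin; apply: Finf; exact: finite_image.
(* An enumeration of the preimages is turned into one of [F] by taking images,
   since every [u n] is saturated with respect to [h]. *)
- have un n : (preimage h @` F) (u n) by rewrite Fu; exists n.
  have uK n : h @^-1` (h @` u n) = u n.
    by have [W _ <-] := un n; rewrite image_preimage.
  have Fw : F = range (fun n => h @` u n).
    rewrite -[RHS](image_comp u (image^~ h)) -Fu image_comp -[LHS]image_id.
    by apply: eq_imagel => W _ /=; rewrite image_preimage.
  exists (fun n => h @` u n); split=> //.
  + move=> n; split; first by apply: Fo; rewrite Fw; exists n.
    by move/(preimage_eqT hs); rewrite uK; case: (uo n).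
  + apply/(preimage_eqT hs); rewrite preimage_bigcup -uT.
    exact: eq_bigcupr.
  + move=> _ [K CK <-]; have [n0 uKn] := uC _ CK.
    by exists n0 => n /uKn Kn; rewrite image_sub uK.
Qed.

(** * Selection principles and preimages *)

(** Taking preimages has to carry [A'] into [A], and membership in [D] has to
    come back to [D'].  The second condition is applied to families made of
    members of the given covers, or of unions of such members, which is why
    families of open sets suffice there. *)
Lemma selects_preimage {X : Type} {Z : topologicalType} {h : X -> Z}
    (hs : range h = setT) {A D : set (set (set X))} {A' D' : set (set (set Z))}
    (Ao : forall F, A' F -> F `<=` open)
    (AA' : forall F, A' F -> A (preimage h @` F))
    (DD' : forall F, F `<=` open -> D (preimage h @` F) -> D' F)
    (P : selection_principle) :
  selects P A D -> selects P A' D'.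
Proof.
case: P => /= sel U A'U;
    have {sel} := sel (fun n => preimage h @` U n) (fun n => AA' _ (A'U n)).
- move=> [V [VU DV]].
  have VUK n : U n (h @` V n) /\ h @^-1` (h @` V n) = V n.
    by have [W UW <-] := VU n; rewrite image_preimage.
  exists (fun n => h @` V n); split=> [n|]; first by case: (VUK n).
  apply: DD' => [_ [n _ <-]|]; first by apply: (Ao _ (A'U n)); case: (VUK n).
  rewrite range_preimage; suff -> : (fun n => h @^-1` (h @` V n)) = V by [].
  by apply/funext => n; case: (VUK n).
- move=> [V [VU DV]].
  have VsubU n : image^~ h @` V n `<=` U n.
    by apply: image_of_preimages_sub => //; case: (VU n).
  exists (fun n => image^~ h @` V n); split=> [n|].
    by split=> //; apply: finite_image; case: (VU n).
  apply: DD' => [W [n _ /VsubU UW]|]; first exact: (Ao _ (A'U n)).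
  rewrite image_bigcup; congr (D _): DV; apply: eq_bigcupr => n _.
  by rewrite (preimages_of_image hs (VU n).2).
- move=> [V [VU selV]].
  have VsubU n : image^~ h @` V n `<=` U n.
    by apply: image_of_preimages_sub => //; case: (VU n).
  have unionK n :
      h @^-1` (\bigcup_(W in image^~ h @` V n) W) = \bigcup_(W in V n) W.
    rewrite preimage_bigcup -[in RHS](preimages_of_image hs (VU n).2).
    by rewrite [in RHS]bigcup_image.
  exists (fun n => image^~ h @` V n); split=> [n|].
    by split=> //; apply: finite_image; case: (VU n).
  case: selV => [DV|[n VT]]; [left|right]; last first.
    by exists n; apply/(preimage_eqT hs); rewrite unionK.
  apply: DD' => [_ [n _ <-]|].
    by apply: bigcup_open => W VW; apply/(Ao _ (A'U n))/VsubU.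
  by rewrite range_preimage; under eq_fun do rewrite unionK.
Qed.

(** * The corestriction of a map to its range *)

Definition corestrict {X Y : Type} (g : X -> Y) (x : X) : range g :=
  SigSub (mem_set (imageT g x)).

Lemma corestrictE {X Y : Type} (g : X -> Y) (x : X) :
  set_val (corestrict g x) = g x.
Proof. by rewrite set_valE. Qed.

Lemma range_corestrict {X Y : Type} (g : X -> Y) :
  range (corestrict g) = setT.
Proof.
apply/seteqP; split=> // z _; have [x _ gx] := set_valP z.
by exists x => //; apply: val_inj; rewrite /= gx.
Qed.

Lemma continuous_corestrict {X Y : topologicalType} {g : X -> Y} :
  continuous g -> continuous (corestrict g).
Proof.
move=> /continuousP gc; apply/continuousP => _ [W Wo <-].
rewrite -comp_preimage.
suff -> : set_val \o corestrict g = g by exact: gc.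
by apply/funext => x; exact: corestrictE.
Qed.

Lemma image_family_corestrict {X Y : Type} (g : X -> Y) (B : set (set X)) :
  image_family g B = image^~ (corestrict g) @` B.
Proof.
apply: eq_imagel => K _; apply/seteqP; split=> [z [x Kx gxz]|z [x Kx <-]].
  by exists x => //; apply: val_inj; rewrite /= gxz set_valE.
by exists x => //; rewrite corestrictE.
Qed.

Theorem proposition4p8 (X Y : topologicalType) (B B0 : set (set X))
    (hB : is_bornology B) (hB0 : is_closed_base B B0)
    (g : X -> Y) (hg : continuous g) (P : selection_principle) :
  [/\ selects P (open_covers B) (open_covers B) ->
      selects P (open_covers (image_family g B))
                (open_covers (image_family g B)),
      selects P (open_covers B) (gamma_covers B) ->
      selects P (open_covers (image_family g B))
                (gamma_covers (image_family g B)),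
      selects P (gamma_covers B) (gamma_covers B) ->
      selects P (gamma_covers (image_family g B))
                (gamma_covers (image_family g B)) &
      selects P (gamma_covers B) (open_covers B) ->
      selects P (gamma_covers (image_family g B))
                (open_covers (image_family g B))].
Proof.
have hs := range_corestrict g.
have hc := continuous_corestrict hg.
rewrite image_family_corestrict.
have Oo F := @open_covers_open _ (image^~ (corestrict g) @` B) F.
have Go F := @gamma_covers_open _ (image^~ (corestrict g) @` B) F.
have OE := open_covers_preimage hc hs B.
have GE := gamma_covers_preimage hc hs B.
have Opre F OF := (OE F (Oo F OF)).1 OF.
have Gpre F GF := (GE F (Go F GF)).1 GF.
have Oimg F Fo := (OE F Fo).2.
have Gimg F Fo := (GE F Fo).2.
split.
- exact: (selects_preimage hs Oo Opre Oimg).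
- exact: (selects_preimage hs Oo Opre Gimg).
- exact: (selects_preimage hs Go Gpre Gimg).
- exact: (selects_preimage hs Go Gpre Oimg).
Qed.
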